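(* Let $g\ge 1$ and $n\ge 1$, and let $R_{g,n}$ be the kernel of the epimorphism $\varphi_n:B_{g,n}\to\widetilde{B}_n$. The group $R_{g,n}$ has the following decompositions as iterated (internal) semi-direct products: 1) $R_{g,n} = \overline{U}_{g,g+n} \rtimes \bigl(\overline{U}_{g,g+n-1} \rtimes ( \cdots \rtimes (\overline{U}_{g,g+2} \rtimes \overline{U}_{g,g+1})\cdots )\bigr)$, where $\overline{U}_{g,g+1}=U_{g+1}$; 2) $R_{g,n} = \overline{V}_{g,1} \rtimes \bigl(\overline{V}_{g,2} \rtimes ( \cdots \rtimes (\overline{V}_{g,g-1} \rtimes \overline{V}_{g,g})\cdots )\bigr)$, where $\overline{V}_{g,g}=V_g$.
   Context: For $m\ge 2$, $B_m$ is the Artin braid group on $m$ strings with generators $\sigma_1,\dots,\sigma_{m-1}$ and relations $\sigma_i\sigma_j=\sigma_j\sigma_i$ for $|i-j|>1$, $\sigma_i\sigma_{i+1}\sigma_i=\sigma_{i+1}\sigma_i\sigma_{i+1}$ for $1\le i\le m-2$. For $1\le i<j\le m$ put $a_{ij}=\sigma_{j-1}\sigma_{j-2}\cdots\sigma_{i+1}\sigma_i^2\sigma_{i+1}^{-1}\cdots\sigma_{j-2}^{-1}\sigma_{j-1}^{-1}$; these generate the pure braid group $P_m$. The braid group $B_{g,n}$ on $n$ strings in the handlebody of genus $g$ is the group with generators $\tau_1,\dots,\tau_g,\sigma_{g+1},\dots,\sigma_{g+n-1}$ and relations: $\sigma_i\sigma_j=\sigma_j\sigma_i$ for $|i-j|>1$;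 $\sigma_i\sigma_{i+1}\sigma_i=\sigma_{i+1}\sigma_i\sigma_{i+1}$ for $g+1\le i\le g+n-2$; $\tau_k\sigma_i=\sigma_i\tau_k$ for $1\le k\le g$, $i\ge g+2$; $\tau_k(\sigma_{g+1}\tau_k\sigma_{g+1})=(\sigma_{g+1}\tau_k\sigma_{g+1})\tau_k$ for $1\le k\le g$; $\tau_k(\sigma_{g+1}^{-1}\tau_{k+l}\sigma_{g+1})=(\sigma_{g+1}^{-1}\tau_{k+l}\sigma_{g+1})\tau_k$ for $1\le k\le g-1$, $1\le l\le g-k$. It is identified with the subgroup of $B_{g+n}$ generated by $\tau_k=a_{k,g+1}$ ($1\le k\le g$) and $\sigma_{g+1},\dots,\sigma_{g+n-1}$ (braids leaving the first $g$ strings unbraided); all $a_{ij}$ below are taken in $B_{g+n}$. $\widetilde{B}_n=\langle\sigma_{g+1},\dots,\sigma_{g+n-1}\rangle\cong B_n$, and $\widetilde{P}_n=\langle a_{ij} : g+1\le i<j\le g+n\rangle\cong P_n$ is its pure braid group. The epimorphism $\varphi_n:B_{g,n}\to\widetilde{B}_n$ is given by $\varphi_n(\tau_k)=1$ for $1\le k\le g$ and $\varphi_n(\sigma_i)=\sigma_i$ for $g+1\le i\le g+n-1$. In $P_{g+n}$: for $2\le k\le g+n$, $U_k=\langle a_{1k},a_{2k},\dots,a_{k-1,k}\rangle$ (a free group of rank $k-1$); for $1\le i\le n$, $U_{g,g+i}=\langle a_{1,g+i},a_{2,g+i},\dots,a_{g,g+i}\rangle\le U_{g+i}$, and $\overline{U}_{g,g+i}$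 is the normal closure of $U_{g,g+i}$ in $U_{g+i}$. For $1\le k\le g+n-1$, $V_k=\langle a_{k,k+1},a_{k,k+2},\dots,a_{k,g+n}\rangle$ (so $V_g=\langle a_{g,g+1},\dots,a_{g,g+n}\rangle$). For $1\le i\le g$, $V_{g,i}=\langle a_{i,g+1},a_{i,g+2},\dots,a_{i,g+n}\rangle$, and $\overline{V}_{g,i}$ is the normal closure of $V_{g,i}$ in the subgroup $\langle V_{g,i},V_{g,i+1},\dots,V_{g,g},\widetilde{P}_n\rangle$. In a semi-direct product $A\rtimes B$ the factor $A$ is the normal one. *)

(* Defs.v *)
From HB Require Import structures.
From mathcomp Require Import all_boot.
From mathcomp Require Import boolp classical_sets.
From mathcomp Require Import zify.

Set Implicit Arguments.
Unset Strict Implicit.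
Unset Printing Implicit Defensive.

Local Open Scope classical_set_scope.
Local Open Scope group_scope.
Local Open Scope quotient_scope.

(* The letter (x, false) is the generator x and (x, true) is its inverse. *)
Definition word (X : Type) := seq (X * bool).

Section PresentedGroup.
Variables (X : choiceType) (r : word X -> word X -> Prop).

Definition letter_inv (l : X * bool) : X * bool := (l.1, ~~ l.2).
Definition word_inv (w : word X) : word X := rev (map letter_inv w).

(* The least congruence of words containing the relations u = v (for r u v)
   and the cancellations x x^-1 = x^-1 x = 1. *)
Inductive pres_eq : word X -> word X -> Prop :=
| pres_eq_refl w : pres_eq w w
| pres_eq_sym u v : pres_eq u v -> pres_eq v u
| pres_eq_trans v u w : pres_eq u v -> pres_eq v w -> pres_eq u w
| pres_eq_cat u u' v v' :
    pres_eq u u' -> pres_eq v v' -> pres_eq (u ++ v) (u' ++ v')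
| pres_eq_cancel l : pres_eq [:: l; letter_inv l] [::]
| pres_eq_rel u v : r u v -> pres_eq u v.

Lemma pres_eq_inv u v : pres_eq u v -> pres_eq (word_inv u) (word_inv v).
Proof.
have invr w : pres_eq (w ++ word_inv w) [::].
  elim: w => [|l w IH]; first exact: pres_eq_refl.
  rewrite /word_inv /= rev_cons -cats1 -cat1s -(cats0 [::]).
  apply: (pres_eq_trans (v := [:: l] ++ [::] ++ [:: letter_inv l])).
    apply: pres_eq_cat; first exact: pres_eq_refl.
    rewrite catA; apply: pres_eq_cat; [exact: IH | exact: pres_eq_refl].
  exact: pres_eq_cancel.
have invl w : pres_eq (word_inv w ++ w) [::].
  elim/last_ind: w => [|w l IH]; first exact: pres_eq_refl.
  rewrite /word_inv map_rcons rev_rcons -cats1 -cat1s -catA.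
  apply: (pres_eq_trans (v := [:: letter_inv l] ++ [::] ++ [:: l])).
    apply: pres_eq_cat; first exact: pres_eq_refl.
    rewrite catA; apply: pres_eq_cat; [exact: IH | exact: pres_eq_refl].
  have := pres_eq_cancel (letter_inv l).
  by rewrite /letter_inv /= negbK -surjective_pairing.
move=> uv; apply: (pres_eq_trans (v := word_inv u ++ (v ++ word_inv v))).
  rewrite -{1}[word_inv u]cats0.
  by apply: pres_eq_cat; [exact: pres_eq_refl | exact/pres_eq_sym/invr].
rewrite catA -{2}[word_inv v]cat0s.
apply: pres_eq_cat; last exact: pres_eq_refl.
apply: (pres_eq_trans (v := word_inv u ++ u)); last exact: invl.
by apply: pres_eq_cat; [exact: pres_eq_refl | exact: pres_eq_sym].
Qed.

Definition pres_eqb : rel (word X) := fun u v => `[< pres_eq u v >].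

Fact pres_eqb_equiv : equiv_class_of pres_eqb.
Proof.
split=> [w|u v|v u w]; first by apply/asboolP; exact: pres_eq_refl.
- by apply/asboolP/asboolP; exact: pres_eq_sym.
- by move=> /asboolP uv /asboolP vw; apply/asboolP; exact: pres_eq_trans vw.
Qed.

Canonical pres_equiv := EquivRelPack pres_eqb_equiv.

Definition pres : Type := {eq_quot pres_equiv}.
HB.instance Definition _ := Choice.on pres.

Definition pres_of (w : word X) : pres := \pi_({eq_quot pres_equiv}) w.
Definition pres_repr (x : pres) : word X := repr (x : {eq_quot pres_equiv}).

Lemma pres_reprK x : pres_of (pres_repr x) = x.
Proof. exact: reprK. Qed.

Lemma pres_ofP u v : pres_of u = pres_of v <-> pres_eq u v.
Proof.
by split=> [/eqmodP /asboolP // | uv]; apply/eqmodP/asboolP.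
Qed.

Lemma pres_reprP w : pres_eq (pres_repr (pres_of w)) w.
Proof. by apply/pres_ofP; rewrite pres_reprK. Qed.

Definition pres_mul (x y : pres) := pres_of (pres_repr x ++ pres_repr y).
Definition pres_one := pres_of [::].
Definition pres_inv (x : pres) := pres_of (word_inv (pres_repr x)).

Lemma pres_mulE u v : pres_mul (pres_of u) (pres_of v) = pres_of (u ++ v).
Proof. by apply/pres_ofP/pres_eq_cat; exact: pres_reprP. Qed.

Lemma pres_invE u : pres_inv (pres_of u) = pres_of (word_inv u).
Proof. by apply/pres_ofP/pres_eq_inv; exact: pres_reprP. Qed.

Fact pres_mulA : associative pres_mul.
Proof.
move=> x y z; rewrite -(pres_reprK x) -(pres_reprK y) -(pres_reprK z).
by rewrite !pres_mulE catA.
Qed.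

Fact pres_mul1 : left_id pres_one pres_mul.
Proof. by move=> x; rewrite -(pres_reprK x) pres_mulE. Qed.

Fact pres_mul1r : right_id pres_one pres_mul.
Proof. by move=> x; rewrite -(pres_reprK x) pres_mulE cats0. Qed.

Fact pres_mulr_inv : right_inverse pres_one pres_inv pres_mul.
Proof.
move=> x; rewrite -(pres_reprK x) pres_invE pres_mulE; apply/pres_ofP.
elim: (pres_repr x) => [|l w IH]; first exact: pres_eq_refl.
rewrite /word_inv /= rev_cons -cats1 -cat1s.
apply: (pres_eq_trans (v := [:: l] ++ [::] ++ [:: letter_inv l])).
  apply: pres_eq_cat; first exact: pres_eq_refl.
  rewrite catA; apply: pres_eq_cat; [exact: IH | exact: pres_eq_refl].
exact: pres_eq_cancel.
Qed.

Fact pres_mull_inv : left_inverse pres_one pres_inv pres_mul.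
Proof.
have invK x : pres_inv (pres_inv x) = x.
  rewrite -(pres_reprK x) !pres_invE /word_inv map_rev revK -map_comp.
  rewrite (eq_map (g := id)) ?map_id // => -[i b].
  by rewrite /= /letter_inv /= negbK.
by move=> x; rewrite -{2}(invK x) pres_mulr_inv.
Qed.

HB.instance Definition _ :=
  isGroup.Build pres pres_mulA pres_mul1 pres_mul1r pres_mull_inv
    pres_mulr_inv.

Definition pres_gen (x : X) : pres := pres_of [:: (x, false)].

Section Lift.
Variables (G : groupType) (f : X -> G).

Definition letter_eval (l : X * bool) : G := if l.2 then (f l.1)^-1 else f l.1.
Definition word_eval (w : word X) : G := \prod_(l <- w) letter_eval l.

Definition respects := forall u v, r u v -> word_eval u = word_eval v.

Lemma word_eval_pres_eq : respects ->
  forall u v, pres_eq u v -> word_eval u = word_eval v.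
Proof.
move=> fr u v; elim=> {u v} //.
- by move=> v u w _ -> _ ->.
- by move=> u u' v v' _ Hu _ Hv; rewrite /word_eval !big_cat /= -!/(word_eval _) Hu Hv.
- move=> [x b]; rewrite /word_eval 2!big_cons big_nil mulg1.
  by case: b; rewrite /letter_eval /= ?mulVg ?mulgV.
Qed.

(* The homomorphism out of the presented group extending f. *)
Definition pres_lift (fr : respects) (x : pres) : G := word_eval (pres_repr x).

Variable fr : respects.

Lemma pres_lift_of w : pres_lift fr (pres_of w) = word_eval w.
Proof. exact/word_eval_pres_eq/pres_reprP. Qed.

Lemma pres_lift_gen x : pres_lift fr (pres_gen x) = f x.
Proof. by rewrite pres_lift_of /word_eval big_seq1. Qed.

Fact pres_lift_morph : monoid_morphism (pres_lift fr).
Proof.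
split=> [|x y]; first by rewrite [LHS]pres_lift_of /word_eval big_nil.
by rewrite [LHS]pres_lift_of /word_eval big_cat.
Qed.

HB.instance Definition _ := isUMagmaMorphism.Build pres G (pres_lift fr)
  pres_lift_morph.

End Lift.

Lemma pres_of_prod w : pres_of w = word_eval pres_gen w.
Proof.
elim: w => [|[x b] w IH]; first by rewrite /word_eval big_nil.
rewrite /word_eval big_cons -/(word_eval _ _) -IH -cat1s -[LHS]pres_mulE.
congr (_ * _); rewrite /letter_eval; case: b => //=.
by rewrite [RHS]pres_invE.
Qed.

Lemma pres_gen_rel u v : r u v -> word_eval pres_gen u = word_eval pres_gen v.
Proof. by move=> ruv; rewrite -!pres_of_prod; apply/pres_ofP/pres_eq_rel. Qed.

End PresentedGroup.

Section Subgroups.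
Variable G : groupType.
Implicit Types A B H K N : set G.

Definition subgroup H : Prop :=
  [/\ H 1, forall x y, H x -> H y -> H (x * y) & forall x, H x -> H x^-1].

Definition generated A : set G := smallest subgroup A.

Definition normal_in H N : Prop :=
  [/\ subgroup N, N `<=` H & forall x h, N x -> H h -> N (x ^ h)].

Definition normal_closure H A : set G := smallest (normal_in H) A.

(* K is the internal semidirect product of its normal subgroup A and of B. *)
Definition semidirect A B K : Prop :=
  [/\ normal_in K A, subgroup B /\ B `<=` K,
      A `&` B = [set 1] & [set x * y | x in A & y in B] = K].

(* iter_semidirect [:: A1; ...; Ak] K means K = A1 ><| (A2 ><| (... ><| Ak)). *)
Fixpoint iter_semidirect (s : seq (set G)) K : Prop :=
  match s with
  | [::] => K = [set 1]
  | [:: A] => K = A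
  | A :: s' => exists2 H, iter_semidirect s' H & semidirect A H K
  end.

End Subgroups.

Section LiftRange.
Variables (X : choiceType) (r : word X -> word X -> Prop) (G : groupType).
Variables (f : X -> G) (fr : respects r f).

Lemma pres_lift_range : range (pres_lift fr) = generated (range f).
Proof.
apply/seteqP; split=> [_ [x _ <-]|y].
  move=> H [[H1 HM HV] fH]; rewrite /pres_lift /word_eval.
  elim: (pres_repr x) => [|l w IH]; rewrite ?big_nil ?big_cons //.
  apply: HM IH; rewrite /letter_eval; case: ifP => _; first apply: HV.
  - by apply: fH; exists l.1.
  - by apply: fH; exists l.1.
apply; split; last by move=> _ [x _ <-]; exists (pres_gen r x); rewrite ?pres_lift_gen.
split=> [|_ _ [x _ <-] [y' _ <-]|_ [x _ <-]].
- by exists 1; rewrite ?gmulf1.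
- by exists (x * y'); rewrite ?gmulfM.
- by exists x^-1; rewrite ?gmulfV.
Qed.

End LiftRange.

Notation idx a b := {i : nat | (a <= i < b)%N}.

Definition ltr (X : Type) (x : X) : word X := [:: (x, false)].
Definition ltrV (X : Type) (x : X) : word X := [:: (x, true)].

Section Braids.
Variable m : nat.

Inductive braid_rel : word (idx 1 m) -> word (idx 1 m) -> Prop :=
| braid_rel_far (i j : idx 1 m) :
    ((val i).+1 < val j)%N || ((val j).+1 < val i)%N ->
    braid_rel (ltr i ++ ltr j) (ltr j ++ ltr i)
| braid_rel_adj (i j : idx 1 m) : val j = (val i).+1 ->
    braid_rel (ltr i ++ ltr j ++ ltr i) (ltr j ++ ltr i ++ ltr j).

Definition braid : Type := pres braid_rel.
HB.instance Definition _ := Group.on braid.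

(* Junk value 1 unless 1 <= i < m. *)
Definition sigma (i : nat) : braid :=
  if insub i is Some j then pres_gen braid_rel j else 1.

(* Junk value unless 1 <= i < j <= m. *)
Definition apure (i j : nat) : braid :=
  let c := \prod_(k <- rev (index_iota i.+1 j)) sigma k in
  c * sigma i ^+ 2 * c^-1.

Lemma sigma_val (i : idx 1 m) : sigma (val i) = pres_gen braid_rel i.
Proof. by rewrite /sigma valK. Qed.

Lemma sigma_far i j : (i.+1 < j)%N || (j.+1 < i)%N ->
  commute (sigma i) (sigma j).
Proof.
move=> ij; rewrite /commute.
have [bi|bi] := boolP (0 < i < m)%N; last by rewrite {1 4}/sigma insubN ?mul1g ?mulg1.
have [bj|bj] := boolP (0 < j < m)%N; last by rewrite {2 3}/sigma insubN ?mul1g ?mulg1.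
have := pres_gen_rel (@braid_rel_far (Sub i bi) (Sub j bj) ij).
rewrite /word_eval /ltr !big_cons !big_nil /letter_eval /= !mulg1.
by rewrite -(sigma_val (Sub i bi)) -(sigma_val (Sub j bj)).
Qed.

Lemma sigma_adj i : (0 < i)%N -> (i.+1 < m)%N ->
  sigma i * sigma i.+1 * sigma i = sigma i.+1 * sigma i * sigma i.+1.
Proof.
move=> i0 im; have bi : (1 <= i < m)%N by lia.
have bj : (1 <= i.+1 < m)%N by lia.
have := pres_gen_rel (@braid_rel_adj (Sub i bi) (Sub i.+1 bj) erefl).
rewrite /word_eval /ltr !big_cons !big_nil /letter_eval /= !mulg1.
by rewrite -(sigma_val (Sub i bi)) -(sigma_val (Sub i.+1 bj)) !mulgA.
Qed.

Lemma commuteJ (x y z : braid) : commute x z -> commute y z ->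
  commute (x ^ y) z.
Proof.
move=> xz yz; apply/commute_sym; rewrite conjgE.
apply: commuteM; first exact/commuteV/commute_sym.
by apply: commuteM; exact/commute_sym.
Qed.

Lemma commute_conj (x y z : braid) : commute x y -> commute (x ^ z) (y ^ z).
Proof. by move=> xy; rewrite /commute -!conjMg xy. Qed.

Lemma commuteVl (x y : braid) : commute x y -> commute x^-1 y.
Proof. by move=> xy; apply/commute_sym/commuteV/commute_sym. Qed.

Lemma apure0 i : apure i i.+1 = sigma i ^+ 2.
Proof. by rewrite /apure /index_iota subnn big_nil invg1 mulg1 mul1g. Qed.

Lemma apureS i j : (i < j)%N -> apure i j.+1 = apure i j ^ (sigma j)^-1.
Proof.
move=> ij; rewrite /apure /index_iota (_ : j.+1 - i.+1 = (j - i.+1).+1)%N; last lia.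
rewrite -(addn1 (j - i.+1)) iotaD rev_cat big_cons /= (_ : i.+1 + _ = j)%N; last lia.
by rewrite conjgE invgK invgM !mulgA.
Qed.

Lemma apure_ind (z : braid) i j : (i < j)%N ->
  (forall l, (i <= l < j)%N -> commute (sigma l) z) -> commute (apure i j) z.
Proof.
elim: j => // j IH; rewrite ltnS leq_eqVlt => /predU1P[<-|ij] H.
  by rewrite apure0; apply/commute_sym/commuteX/commute_sym/H; lia.
rewrite apureS //; apply: commuteJ; last by apply/commuteVl/H; lia.
by apply: IH => // l lj; apply: H; lia.
Qed.

Lemma apure_far i j l : (i < j)%N -> (l.+1 < i)%N || (j < l)%N ->
  commute (apure i j) (sigma l).
Proof. by move=> ij l_; apply: apure_ind => // k kij; apply: sigma_far; lia. Qed.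

Lemma apure_low i j : (0 < i)%N -> (i.+1 < j <= m)%N ->
  apure i j = apure i.+1 j ^ sigma i.
Proof.
move=> i0; elim: j => // j IH /andP[]; rewrite ltnS leq_eqVlt.
move=> /predU1P[<-|ij] im.
  rewrite apureS // !apure0.
  have E := sigma_adj i0 im.
  have {E} : sigma i.+1 ^ sigma i = sigma i ^ (sigma i.+1)^-1.
    apply: (mulgI (sigma i)); apply: (mulIg (sigma i.+1)).
    by rewrite !conjgE invgK !mulgA mulgV mul1g -E mulgVK.
  by rewrite !conjXg => ->.
rewrite apureS ?IH ?apureS; [|lia..].
by rewrite -!conjgM; congr (_ ^ _); apply/commuteV/sigma_far; lia.
Qed.

Lemma apure_mid k i j : (0 < k)%N -> (k < i)%N -> (i.+1 < j <= m)%N ->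
  commute (apure k j) (sigma i).
Proof.
move=> k0 ki; elim: j => // j IH /andP[]; rewrite ltnS leq_eqVlt.
move=> /predU1P[<-|ij] im; last first.
  rewrite apureS; last lia.
  by apply: commuteJ; [apply: IH; lia | apply/commuteVl/sigma_far; lia].
rewrite !apureS //; last lia; rewrite -conjgM -invgM.
set c := sigma i.+1 * sigma i.
have E : sigma i = sigma i.+1 ^ c^-1.
  apply: (mulIg c); rewrite -conjgCV /c !mulgA.
  by rewrite sigma_adj //; lia.
rewrite E; apply/commute_conj/apure_far; lia.
Qed.

Lemma apure_nested k l j j' : (0 < k < l)%N -> (l < j < j')%N -> (j' <= m)%N ->
  commute (apure k j') (apure l j).
Proof.
move=> kl lj jm; apply/commute_sym/apure_ind => [|i ij]; first lia.
apply/commute_sym/apure_mid; lia.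
Qed.

Lemma apure_braid4 k j : (0 < k < j)%N -> (j < m)%N ->
  commute (apure k j) (sigma j * apure k j * sigma j).
Proof.
move=> /andP[k0 kj] jm; have [d dE] : exists d, j = (k + d).+1.
  by exists (j - k.+1)%N; lia.
elim: d k k0 kj dE => [|d IH] k k0 kj dE.
  have -> : j = k.+1 by lia.
  have {}jm : (k.+1 < m)%N by lia.
  rewrite apure0 !expgS expg0 mulg1.
  set s := sigma k; set t := sigma k.+1.
  have E : s * t * s = t * s * t by exact: sigma_adj.
  rewrite /commute.
  have E1 : s * (t * (s * s) * t) = t * (s * s) * t * s.
    transitivity (s * t * s * (s * t)); first by rewrite !mulgA.
    transitivity (t * s * (s * t * s)); last by rewrite !mulgA.
    by rewrite E !mulgA.
  by rewrite -mulgA E1 mulgA E1 !mulgA.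
have kj' : (k.+1 < j)%N by lia.
have -> : apure k j = apure k.+1 j ^ sigma k by apply: apure_low; lia.
have kc : sigma j = sigma j ^ sigma k.
  by apply/esym/conjg_fixP/commgP/sigma_far; lia.
rewrite {1 2}kc -!conjMg; apply/commute_conj/IH; lia.
Qed.

Lemma apure_braid5 k l j : (0 < k < l)%N -> (l < j < m)%N ->
  commute (apure k j) ((sigma j)^-1 * apure l j * sigma j).
Proof.
move=> kl lj; rewrite -mulgA -conjgE.
have -> : apure k j = apure k j.+1 ^ sigma j.
  by rewrite apureS -?conjgM ?mulVg ?conjg1 //; lia.
by apply/commute_conj/apure_nested; lia.
Qed.

End Braids.

Section Handlebody.
Variables g n : nat.

(* tau_1, ..., tau_g on the left, sigma_(g+1), ..., sigma_(g+n-1) on the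
   right. *)
Definition hb_idx : Type := (idx 1 g.+1 + idx g.+1 (g + n))%type.
HB.instance Definition _ := Choice.on hb_idx.

Local Notation T k := (ltr (inl k : hb_idx)).
Local Notation S i := (ltr (inr i : hb_idx)).
Local Notation SV i := (ltrV (inr i : hb_idx)).

Inductive hb_rel : word hb_idx -> word hb_idx -> Prop :=
| hb_rel_far (i j : idx g.+1 (g + n)) :
    ((val i).+1 < val j)%N || ((val j).+1 < val i)%N ->
    hb_rel (S i ++ S j) (S j ++ S i)
| hb_rel_adj (i j : idx g.+1 (g + n)) : val j = (val i).+1 ->
    hb_rel (S i ++ S j ++ S i) (S j ++ S i ++ S j)
| hb_rel_tau_sigma (k : idx 1 g.+1) (i : idx g.+1 (g + n)) :
    (g.+2 <= val i)%N ->
    hb_rel (T k ++ S i) (S i ++ T k)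
| hb_rel_tau (k : idx 1 g.+1) (i : idx g.+1 (g + n)) : val i = g.+1 ->
    hb_rel (T k ++ (S i ++ T k ++ S i)) ((S i ++ T k ++ S i) ++ T k)
| hb_rel_tau_tau (k k' : idx 1 g.+1) (i : idx g.+1 (g + n)) :
    (val k < val k')%N -> val i = g.+1 ->
    hb_rel (T k ++ (SV i ++ T k' ++ S i)) ((SV i ++ T k' ++ S i) ++ T k).

Definition hb_braid : Type := pres hb_rel.
HB.instance Definition _ := Group.on hb_braid.

Definition hb_embed_gen (x : hb_idx) : braid (g + n) :=
  match x with inl k => apure _ (val k) g.+1 | inr i => sigma _ (val i) end.

Fact hb_embed_respects : respects hb_rel hb_embed_gen.
Proof.
have ti (k : idx 1 g.+1) : (0 < val k <= g)%N by have /= := valP k; lia.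
have si (i : idx g.+1 (g + n)) : (g < val i < g + n)%N by have /= := valP i; lia.
move=> _ _ [i j ij|i j ij|k i gi|k i ig|k k' i kk' ig];
  rewrite /word_eval !big_cons !big_nil /letter_eval !mulg1 /=.
- exact: sigma_far.
- have /= := si i; have /= := si j; move: ij => /= -> *.
  by rewrite !mulgA sigma_adj //; lia.
- by have /= := ti k; move: gi => /= *; apply: apure_far; lia.
- have /= := ti k; have /= := si i; move: ig => /= -> sg tk.
  have := @apure_braid4 (g + n) (sval k) g.+1; rewrite /commute.
  by move: (apure _ _ _) => a H; rewrite !mulgA in H *; apply: H; lia.
- have /= := ti k; have /= := ti k'; have /= := si i.
  move: ig kk' => /= -> kk' sg tk tk'.
  have := @apure_braid5 (g + n) (sval k) (sval k') g.+1; rewrite /commute.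
  move: (apure _ (sval k) _) (apure _ (sval k') _) => a b H.
  by rewrite !mulgA in H *; apply: H; lia.
Qed.

(* The identification of B_(g,n) with a subgroup of B_(g+n); it is a morphism
   onto the subgroup described in hb_embed_range. *)
Definition hb_embed : hb_braid -> braid (g + n) := pres_lift hb_embed_respects.
HB.instance Definition _ :=
  isUMagmaMorphism.Build hb_braid (braid (g + n)) hb_embed
    (pres_lift_morph hb_embed_respects).

Definition hb_phi_gen (x : hb_idx) : braid (g + n) :=
  match x with inl _ => 1 | inr i => sigma _ (val i) end.

Fact hb_phi_respects : respects hb_rel hb_phi_gen.
Proof.
have si (i : idx g.+1 (g + n)) : (g < val i < g + n)%N by have /= := valP i; lia.
move=> _ _ [i j ij|i j ij|k i gi|k i ig|k k' i kk' ig];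
  rewrite /word_eval !big_cons !big_nil /letter_eval /= !(mulg1, mul1g) ?mulgA //.
- exact: sigma_far.
- by have /= := si i; have /= := si j; move: ij => /= -> *; apply: sigma_adj; lia.
Qed.

(* phi_n, with values in B_(g+n); see hb_phi_range for its image. *)
Definition hb_phi : hb_braid -> braid (g + n) := pres_lift hb_phi_respects.
HB.instance Definition _ :=
  isUMagmaMorphism.Build hb_braid (braid (g + n)) hb_phi
    (pres_lift_morph hb_phi_respects).

Definition Btilde : set (braid (g + n)) :=
  generated [set sigma _ i | i in [set i | g < i < g + n]%N].

Definition Ptilde : set (braid (g + n)) :=
  generated [set apure _ ij.1 ij.2 |
    ij in [set ij | [&& g < ij.1, ij.1 < ij.2 & ij.2 <= g + n]%N]].

(* ker phi_n, seen in B_(g+n) through the identification hb_embed. *)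
Definition R : set (braid (g + n)) := hb_embed @` [set x | hb_phi x = 1].

Definition U (k : nat) : set (braid (g + n)) :=
  generated [set apure _ l k | l in [set l | 1 <= l < k]%N].

Definition Ug (i : nat) : set (braid (g + n)) :=
  generated [set apure _ l (g + i) | l in [set l | 1 <= l <= g]%N].

Definition Ubar (i : nat) : set (braid (g + n)) :=
  normal_closure (U (g + i)) (Ug i).

Definition V (k : nat) : set (braid (g + n)) :=
  generated [set apure _ k j | j in [set j | k < j <= g + n]%N].

Definition Vg (i : nat) : set (braid (g + n)) :=
  generated [set apure _ i j | j in [set j | g < j <= g + n]%N].

Definition Vbar (i : nat) : set (braid (g + n)) :=
  normal_closure
    (generated ((\bigcup_(j in [set j | i <= j <= g]%N) Vg j) `|` Ptilde))
    (Vg i).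

Lemma hb_embed_range : range hb_embed =
  generated ([set apure _ k g.+1 | k in [set k | 1 <= k <= g]%N] `|`
             [set sigma _ i | i in [set i | g < i < g + n]%N]).
Proof.
rewrite [LHS]pres_lift_range; congr generated; apply/seteqP; split=> y.
  case=> -[[k hk]|[i hi]] _ <- /=; last by right; exists i.
  by left; exists k.
move=> [[k /= hk]|[i /= hi]] <-.
- by exists (inl (Sub k hk)).
- by exists (inr (Sub i hi)).
Qed.

Lemma hb_phi_range : range hb_phi = Btilde.
Proof.
rewrite [LHS]pres_lift_range; apply/seteqP; split=> y gy H [HS fH].
  apply: gy; split=> // _ [[k|[i hi]] _ <-] /=; first by case: HS.
  by apply: fH; exists i.
by apply: gy; split=> // _ [i /= hi <-]; apply: fH; exists (inr (Sub i hi)).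
Qed.

End Handlebody.

Arguments Btilde g n : clear implicits.
Arguments Ptilde g n : clear implicits.
Arguments R g n : clear implicits.
Arguments U g n k : clear implicits.
Arguments Ug g n i : clear implicits.
Arguments Ubar g n i : clear implicits.
Arguments V g n k : clear implicits.
Arguments Vg g n i : clear implicits.
Arguments Vbar g n i : clear implicits.

(* Main.v *)
(** Deleting a strand is a cocycle on the braid group, hence a homomorphism on
    the stabilizer of that strand; it kills the generators [a_ij] involving the
    strand and fixes the braids lying on one side of it. This gives every
    trivial intersection: [U_k] meets the braids on the first k - 1 strings
    trivially, [Vbar_i] meets the braids on the strings i + 1, ..., g + n
    trivially, and, since deleting the first g strands turns [hb_embed] into
    [hb_phi], [R] meets [Ptilde] trivially.

    Let P(lo, hi) be generated by the [a_ij] with lo <= i < j and g < j <= hi.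
    Then R is a normal subgroup of the handlebody braids contained in
    P(1, g + n), and both chains are obtained by intersecting R with chains of
    the P(lo, hi): R :&: P(1, g + k) = Ubar_k ><| (R :&: P(1, g + k - 1)), with
    Ubar_k = U_(g + k) :&: R, and
    R :&: P(i, g + n) = Vbar_i ><| (R :&: P(i + 1, g + n)). *)

Require Import Defs.
From mathcomp Require Import all_boot.
From mathcomp Require Import boolp classical_sets.
From mathcomp Require Import zify.

Set Implicit Arguments.
Unset Strict Implicit.
Unset Printing Implicit Defensive.

Local Open Scope classical_set_scope.
Local Open Scope group_scope.

(** * Subgroups, normalizers and iterated semidirect products *)

Section SubgroupTheory.
Variable G : groupType.
Implicit Types A B H K N : set G.

Lemma subgroup1 H : subgroup H -> H 1. Proof. by case. Qed.

Lemma subgroupM H x y : subgroup H -> H x -> H y -> H (x * y).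
Proof. by case=> _ HM _; exact: HM. Qed.

Lemma subgroupV H x : subgroup H -> H x -> H x^-1.
Proof. by case=> _ _; apply. Qed.

Lemma subgroupJ H x y : subgroup H -> H x -> H y -> H (x ^ y).
Proof.
move=> sH Hx Hy; rewrite conjgE.
by do ![apply: subgroupM => //]; exact: subgroupV.
Qed.

Lemma subgroupX H x k : subgroup H -> H x -> H (x ^+ k).
Proof.
move=> sH Hx; elim: k => [|k IH]; first by rewrite expg0; exact: subgroup1.
by rewrite expgS; exact: subgroupM.
Qed.

Lemma subgroupI H K : subgroup H -> subgroup K -> subgroup (H `&` K).
Proof.
move=> sH sK; split=> [|x y [Hx Kx] [Hy Ky]|x [Hx Kx]].
- by split; exact: subgroup1.
- by split; exact: subgroupM.
- by split; exact: subgroupV.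
Qed.

Lemma generated_subgroup A : subgroup (generated A).
Proof.
split=> [H [[]]//|x y gx gy H [sH AH]|x gx H [sH AH]].
- by apply: subgroupM => //; [apply: gx | apply: gy].
- by apply: subgroupV => //; apply: gx.
Qed.

Lemma sub_generated A x : A x -> generated A x.
Proof. by move=> Ax H [_]; apply. Qed.

Lemma generated_min A H : subgroup H -> A `<=` H -> generated A `<=` H.
Proof. by move=> sH AH x; apply. Qed.

Lemma generated_mono A B : A `<=` B -> generated A `<=` generated B.
Proof.
move=> AB; apply: generated_min; first exact: generated_subgroup.
by move=> x /AB; exact: sub_generated.
Qed.

(** Both signs are required because in an infinite group a conjugate of [A] may lie properly inside
    [A]; with both, the normalizer is closed under inverses. *)
Definition normalizer A : set G :=
  [set x | forall a, A a -> A (a ^ x) /\ A (a ^ x^-1)].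

Lemma normalizer_subgroup A : subgroup (normalizer A).
Proof.
split=> [a Aa|x y Nx Ny a Aa|x Nx a Aa].
- by rewrite invg1 conjg1.
- rewrite invgM !conjgM; split; first by apply: (Ny _ _).1; exact: (Nx _ _).1.
  by apply: (Nx _ _).2; exact: (Ny _ _).2.
- by rewrite invgK; split; [exact: (Nx _ Aa).2 | exact: (Nx _ Aa).1].
Qed.

Lemma subgroup_normalizer H : subgroup H -> H `<=` normalizer H.
Proof.
by move=> sH x Hx a Ha; split; apply: subgroupJ => //; exact: subgroupV.
Qed.

(** Conjugation is an endomorphism, so the preimage of [generated A] under it is a subgroup, and it
    suffices that it contains [A]. *)
Lemma normalizer_generated A x :
    (forall a, A a -> generated A (a ^ x) /\ generated A (a ^ x^-1)) ->
  normalizer (generated A) x.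
Proof.
have conjP y : (forall a, A a -> generated A (a ^ y)) ->
    forall a, generated A a -> generated A (a ^ y).
  move=> Ay; apply: generated_min => //; have sA := generated_subgroup A.
  split=> [|a b|a] /=; first by rewrite conj1g; exact: subgroup1.
  - by rewrite conjMg; exact: subgroupM.
  - by rewrite conjVg; exact: subgroupV.
move=> Ax a gAa; split; apply: conjP gAa => b Ab.
  exact: (Ax b Ab).1.
exact: (Ax b Ab).2.
Qed.

Lemma normalizerI A B : normalizer A `&` normalizer B `<=` normalizer (A `&` B).
Proof.
move=> x [NA NB] a [Aa Ba]; have [? ?] := NA a Aa; have [? ?] := NB a Ba.
by split; split.
Qed.

Lemma normal_inP H N :
  subgroup N -> N `<=` H -> H `<=` normalizer N -> normal_in H N.
Proof. by move=> sN NH HN; split=> // x h Nx /HN/(_ x Nx)[]. Qed.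

Lemma normal_in_normalizer H N :
  subgroup H -> normal_in H N -> H `<=` normalizer N.
Proof.
by move=> sH [_ _ nN] x Hx a Na; split; apply: nN => //; exact: subgroupV.
Qed.

Lemma sub_normal_closure H A : A `<=` normal_closure H A.
Proof. by move=> x Ax N [_]; apply. Qed.

Lemma normal_closure_min H A N :
  normal_in H N -> A `<=` N -> normal_closure H A `<=` N.
Proof. by move=> nN AN x; apply. Qed.

Lemma normal_closure_normal H A :
  subgroup H -> A `<=` H -> normal_in H (normal_closure H A).
Proof.
move=> sH AH.
have nH : normal_in H H by split=> // x h; exact: subgroupJ.
split; last 1 first.
- by move=> x h cx Hh N [nN AN]; case: (nN) => _ _; apply=> //; apply: cx.
- split=> [N [[[]]]//|x y cx cy N [nN AN]|x cx N [nN AN]].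
  + by case: (nN) => sN _ _; apply: subgroupM => //; [apply: cx | apply: cy].
  + by case: (nN) => sN _ _; apply: subgroupV => //; apply: cx.
- exact: normal_closure_min.
Qed.

Lemma normal_closure_id H N : normal_in H N -> normal_closure H N = N.
Proof.
move=> nN; apply/seteqP; split; last exact: sub_normal_closure.
exact: normal_closure_min.
Qed.

Definition mulset A B : set G := [set x * y | x in A & y in B].

Lemma mulset_subgroup N H :
  subgroup N -> subgroup H -> H `<=` normalizer N -> subgroup (mulset N H).
Proof.
move=> sN sH HN; split.
- by exists 1; [exact: subgroup1|exists 1; [exact: subgroup1|rewrite mulg1]].
- move=> _ _ [x Nx [y Hy <-]] [x' Nx' [y' Hy' <-]].
  exists (x * x' ^ y^-1); first by apply: subgroupM => //; case: (HN y Hy x' Nx').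
  exists (y * y'); first exact: subgroupM.
  by rewrite conjgE invgK !mulgA mulgVK.
- move=> _ [x Nx [y Hy <-]]; exists (x^-1 ^ y).
    by case: (HN y Hy x^-1) => //; exact: subgroupV.
  exists y^-1; first exact: subgroupV.
  by rewrite conjgE invgM !mulgA mulgK.
Qed.

Lemma generated_sub_mulset A N H :
    subgroup N -> subgroup H -> H `<=` normalizer N -> A `<=` N `|` H ->
  generated A `<=` mulset N H.
Proof.
move=> sN sH HN AU; apply: generated_min; first exact: mulset_subgroup.
move=> x /AU[Nx|Hx].
- by exists x => //; exists 1; [exact: subgroup1 | rewrite mulg1].
- by exists 1; [exact: subgroup1 | exists x; rewrite ?mul1g].
Qed.

(** [iter_semidirect] treats one-element lists separately: for empty [s] the complement [H] is
    trivial and the product clause reduces to [K = A]. *)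
Lemma iter_semidirect_cons A s H K :
  iter_semidirect s H -> semidirect A H K -> iter_semidirect (A :: s) K.
Proof.
case: s => [|B s] /= iH sd; last by exists H.
move: sd; rewrite iH => -[_ _ _ <-]; apply/seteqP; split=> [_ [x Ax [_ -> <-]]|x Ax].
  by rewrite mulg1.
by exists x => //; exists 1; rewrite ?mulg1.
Qed.

End SubgroupTheory.

(** * Deletion of a strand *)

Section StrandPosition.
Variable m : nat.
Implicit Types (w : word (idx 1 m)) (x y : braid m).

Definition swap_pos i p :=
  if p == i then i.+1 else if p == i.+1 then i else p.

(** Words act from left to right; the sign of a letter is ignored since a crossing and its inverse
    induce the same transposition. *)
Fixpoint word_pos w p := if w is l :: w' then word_pos w' (swap_pos (val l.1) p) else p.

Lemma word_pos_cat u v p : word_pos (u ++ v) p = word_pos v (word_pos u p).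
Proof. by elim: u p => //= l u IH p. Qed.

Lemma swap_posl i : swap_pos i i = i.+1.
Proof. by rewrite /swap_pos eqxx. Qed.

Lemma swap_posr i : swap_pos i i.+1 = i.
Proof. by rewrite /swap_pos eqxx; case: ifP => //; lia. Qed.

Lemma swap_pos_out i p : (p < i)%N || (i.+1 < p)%N -> swap_pos i p = p.
Proof. by move=> h; rewrite /swap_pos !ifF //; lia. Qed.

Lemma swap_posP i p : [\/ p = i, p = i.+1 | (p < i)%N || (i.+1 < p)%N].
Proof.
have [->|?] := eqVneq p i; first by constructor 1.
have [->|?] := eqVneq p i.+1; first by constructor 2.
by constructor 3; lia.
Qed.

Lemma swap_posK i : involutive (swap_pos i).
Proof.
move=> p; case: (swap_posP i p) => [->|->|h]; rewrite ?(swap_posl, swap_posr) //.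
by rewrite !(swap_pos_out h).
Qed.

Lemma swap_pos_far i j p : (i.+1 < j)%N || (j.+1 < i)%N ->
  swap_pos i (swap_pos j p) = swap_pos j (swap_pos i p).
Proof.
move=> ij; have [->|->|h] := swap_posP i p.
- by rewrite swap_posl !(swap_pos_out (i := j)) ?swap_posl //; lia.
- by rewrite swap_posr !(swap_pos_out (i := j)) ?swap_posr //; lia.
- rewrite (swap_pos_out h); have [->|->|h'] := swap_posP j p.
  + by rewrite swap_posl swap_pos_out //; lia.
  + by rewrite swap_posr swap_pos_out //; lia.
  + by rewrite (swap_pos_out h') swap_pos_out.
Qed.

Lemma swap_pos_adj i p :
  swap_pos i (swap_pos i.+1 (swap_pos i p)) =
  swap_pos i.+1 (swap_pos i (swap_pos i.+1 p)).
Proof.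
have outi : swap_pos i i.+2 = i.+2 by apply: swap_pos_out; lia.
have outi1 : swap_pos i.+1 i = i by apply: swap_pos_out; lia.
have [->|->|h] := swap_posP i p; rewrite ?(swap_posl, swap_posr, outi, outi1) //.
have [->|h'] := eqVneq p i.+2; first by rewrite ?(swap_posl, swap_posr, outi, outi1).
have oi : swap_pos i p = p by exact: swap_pos_out.
have oi1 : swap_pos i.+1 p = p by apply: swap_pos_out; lia.
by rewrite !(oi, oi1).
Qed.

Lemma word_pos_eq u v : pres_eq (@braid_rel m) u v ->
  forall p, word_pos u p = word_pos v p.
Proof.
elim=> {u v} [//|u v _ IH p|v u w _ IHu _ IHv p|u u' v v' _ IHu _ IHv p|[i b] p|u v].
- by rewrite IH.
- by rewrite IHu.
- by rewrite !word_pos_cat IHu IHv.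
- by rewrite /= swap_posK.
- case=> [i j ij|i j jE] p /=; first by apply: swap_pos_far; rewrite orbC.
  by move: jE => /= ->; rewrite swap_pos_adj.
Qed.

Definition braid_pos x p := word_pos (pres_repr x) p.

Lemma braid_pos_of w p : braid_pos (pres_of _ w) p = word_pos w p.
Proof. exact/word_pos_eq/pres_reprP. Qed.

Lemma braid_mulE x y : x * y = pres_of _ (pres_repr x ++ pres_repr y).
Proof. by []. Qed.

Lemma braid_pos1 p : braid_pos 1 p = p.
Proof. exact: (braid_pos_of [::]). Qed.

Lemma braid_posM x y p : braid_pos (x * y) p = braid_pos y (braid_pos x p).
Proof. by rewrite braid_mulE braid_pos_of word_pos_cat. Qed.

Lemma braid_pos_sigma i p : (0 < i < m)%N -> braid_pos (sigma m i) p = swap_pos i p.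
Proof. by move=> im; rewrite (sigma_val (Sub i im)) [LHS]braid_pos_of. Qed.

Lemma braid_posV x p : braid_pos x p = p -> braid_pos x^-1 p = p.
Proof. by move=> xp; rewrite -{1}xp -braid_posM mulgV braid_pos1. Qed.

End StrandPosition.

Section StrandDeletion.
(* Deleting the strand in position p from a braid is a cocycle with values in
   the braid group on one strand less; the latter is sent to [braid m] by
   [sigma i |-> sigma (i + o)], so that the deletion fixes the braids on the
   left (for o = 0) or on the right (for o = 1) of p. *)
Variables (m o : nat).
Hypothesis o1 : (o <= 1)%N.
Implicit Types (w : word (idx 1 m)) (x y : braid m).

(** A crossing of the deleted strand disappears. For [p] outside [1, ..., m] the value is 1:
    otherwise a shifted index could reach 0 or [m], where [sigma] is 1, and the braid relation could
    fail. *)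
Definition sigma_del i p : braid m :=
  if (0 < p <= m)%N then
    if (p < i)%N then sigma m (i.-1 + o)
    else if (i.+1 < p)%N then sigma m (i + o) else 1
  else 1.

Fixpoint word_del w p : braid m :=
  if w is l :: w' then
    (if l.2 then (sigma_del (val l.1) p)^-1 else sigma_del (val l.1) p) *
    word_del w' (swap_pos (val l.1) p)
  else 1.

Lemma word_del_cat u v p :
  word_del (u ++ v) p = word_del u p * word_del v (word_pos u p).
Proof. by elim: u p => [|l u IH] p /=; rewrite ?mul1g // IH mulgA. Qed.

Lemma sigma_del_left i p : (p < i)%N -> (0 < p <= m)%N ->
  sigma_del i p = sigma m (i.-1 + o).
Proof. by move=> h1 h2; rewrite /sigma_del h1 h2. Qed.

Lemma sigma_del_right i p : (i.+1 < p)%N -> (0 < p <= m)%N ->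
  sigma_del i p = sigma m (i + o).
Proof. by move=> h1 h2; rewrite /sigma_del h1 h2 ifF //; lia. Qed.

Lemma sigma_del_mid i p : (i <= p <= i.+1)%N || (p == 0)%N || (m < p)%N ->
  sigma_del i p = 1.
Proof. by move=> h; rewrite /sigma_del; case: ifP => // ?; rewrite !ifF //; lia. Qed.

(** The cocycle rule gives an inverse letter the inverse value at the swapped position; this
    equality lets [word_del] use the unswapped one, and yields the cancellation relation. *)
Lemma sigma_del_swap i p : (0 < i < m)%N ->
  sigma_del i (swap_pos i p) = sigma_del i p.
Proof.
move=> im; case: (swap_posP i p) => [->|->|h]; last by rewrite swap_pos_out.
  by rewrite swap_posl !sigma_del_mid //; lia.
by rewrite swap_posr !sigma_del_mid //; lia.
Qed.

Lemma sigma_del_swap_far i j p : (0 < i < m)%N -> (0 < j < m)%N ->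
  (i.+1 < j)%N || (j.+1 < i)%N -> sigma_del j (swap_pos i p) = sigma_del j p.
Proof.
move=> im jm /orP ij; case: (swap_posP i p) => [->|->|h]; last by rewrite swap_pos_out.
- rewrite swap_posl; case: ij => ij; first by rewrite !sigma_del_left //; lia.
  by rewrite !sigma_del_right //; lia.
- rewrite swap_posr; case: ij => ij; first by rewrite !sigma_del_left //; lia.
  by rewrite !sigma_del_right //; lia.
Qed.

Lemma sigma_del_far i j p : (0 < i < m)%N -> (0 < j < m)%N ->
    (i.+1 < j)%N || (j.+1 < i)%N ->
  sigma_del i p * sigma_del j (swap_pos i p) =
  sigma_del j p * sigma_del i (swap_pos j p).
Proof.
move=> im jm ij; rewrite !sigma_del_swap_far //; last by rewrite orbC.
rewrite /sigma_del; do ![case: ifP => ?]; rewrite ?mulg1 ?mul1g //; try lia.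
all: apply: sigma_far; lia.
Qed.

Lemma sigma_del_adj i p : (0 < i)%N -> (i.+1 < m)%N ->
  sigma_del i p * (sigma_del i.+1 (swap_pos i p) *
    sigma_del i (swap_pos i.+1 (swap_pos i p))) =
  sigma_del i.+1 p * (sigma_del i (swap_pos i.+1 p) *
    sigma_del i.+1 (swap_pos i (swap_pos i.+1 p))).
Proof.
move=> i0 im.
have [pm|pm] := boolP (0 < p <= m)%N; last first.
  have swap_out j q : (0 < j < m)%N -> ~~ (0 < q <= m)%N -> swap_pos j q = q.
    by move=> *; apply: swap_pos_out; lia.
  by rewrite !swap_out //; try lia; rewrite !sigma_del_mid //; lia.
have [pi|pi] := boolP (p < i)%N.
  rewrite !swap_pos_out; try lia.
  rewrite !sigma_del_left; try lia.
  rewrite (_ : i.+1.-1 + o = (i.-1 + o).+1)%N; last lia.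
  by rewrite !mulgA sigma_adj //; lia.
have [pi2|pi2] := boolP (i.+2 < p)%N.
  rewrite !swap_pos_out; try lia.
  rewrite !sigma_del_right; try lia.
  by rewrite addSn !mulgA sigma_adj //; lia.
have outi : swap_pos i i.+2 = i.+2 by apply: swap_pos_out; lia.
have outi1 : swap_pos i.+1 i = i by apply: swap_pos_out; lia.
have del1 : sigma_del i i = 1 by apply: sigma_del_mid; lia.
have del2 : sigma_del i i.+1 = 1 by apply: sigma_del_mid; lia.
have del3 : sigma_del i.+1 i.+1 = 1 by apply: sigma_del_mid; lia.
have del4 : sigma_del i.+1 i.+2 = 1 by apply: sigma_del_mid; lia.
have del5 : sigma_del i i.+2 = sigma m (i + o) by apply: sigma_del_right; lia.
have del6 : sigma_del i.+1 i = sigma m (i + o) by apply: sigma_del_left; lia.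
have swapE := (swap_posl, swap_posr, outi, outi1).
have delE := (del1, del2, del3, del4, del5, del6, @mulg1, @mul1g).
(* In the three remaining positions the strand takes part in exactly two of the three crossings, and
   both sides reduce to [sigma m (i + o)]. *)
have [->|pNi] := eqVneq p i; first by rewrite !swapE !delE.
have [->|pNi1] := eqVneq p i.+1; first by rewrite !swapE !delE.
have -> : p = i.+2 by lia.
by rewrite !swapE !delE.
Qed.

Lemma word_del_eq u v : pres_eq (@braid_rel m) u v ->
  forall p, word_del u p = word_del v p.
Proof.
move=> uv; elim: uv => {u v}
  [//|u v _ IH p|v u w _ IHu _ IHv p|u u' v v' uu' IHu _ IHv p|[i b] p|u v].
- by rewrite IH.
- by rewrite IHu.
- by rewrite !word_del_cat IHu IHv (word_pos_eq uu').
- rewrite /= sigma_del_swap; last by have := valP i.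
  by case: b; rewrite mulg1 ?mulVg ?mulgV.
- case=> [i j ij|i j jE] p; have := valP i; have := valP j => /= jm im.
    by rewrite !mulg1; exact: sigma_del_far.
  rewrite !mulg1; move: jE jm => /= -> jm.
  by rewrite sigma_del_adj //; lia.
Qed.

Definition braid_del x p := word_del (pres_repr x) p.

Lemma braid_del_of w p : braid_del (pres_of _ w) p = word_del w p.
Proof. exact/word_del_eq/pres_reprP. Qed.

Lemma braid_del1 p : braid_del 1 p = 1.
Proof. exact: (braid_del_of [::]). Qed.

Lemma braid_delM x y p :
  braid_del (x * y) p = braid_del x p * braid_del y (braid_pos x p).
Proof. by rewrite braid_mulE braid_del_of word_del_cat. Qed.

Lemma braid_del_sigma i p : (0 < i < m)%N -> braid_del (sigma m i) p = sigma_del i p.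
Proof. by move=> im; rewrite (sigma_val (Sub i im)) [LHS]braid_del_of /= mulg1. Qed.

(** Deletion is multiplicative on the stabilizer of [p], hence the condition on [braid_pos] here and
    in [strand_fix]. *)
Definition strand_ker p : set (braid m) :=
  [set x | braid_pos x p = p /\ braid_del x p = 1].
Definition strand_fix p : set (braid m) :=
  [set x | braid_pos x p = p /\ braid_del x p = x].

Lemma braid_delV x p : braid_pos x p = p -> braid_del x^-1 p = (braid_del x p)^-1.
Proof.
move=> xp; apply: (mulgI (braid_del x p)).
by rewrite -{2}xp -braid_delM !mulgV braid_del1.
Qed.

Lemma strand_fix_subgroup p : subgroup (strand_fix p).
Proof.
split=> [|x y [xp xd] [yp yd]|x [xp xd]] /=.
- by rewrite /strand_fix /= braid_pos1 braid_del1.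
- by rewrite /strand_fix /= braid_posM braid_delM xp yp xd yd.
- by rewrite /strand_fix /= braid_posV // braid_delV // xd.
Qed.

Lemma strand_ker_subgroup p : subgroup (strand_ker p).
Proof.
split=> [|x y [xp xd] [yp yd]|x [xp xd]] /=.
- by rewrite /strand_ker /= braid_pos1 braid_del1.
- by rewrite /strand_ker /= braid_posM braid_delM xp yp xd yd mulg1.
- by rewrite /strand_ker /= braid_posV // braid_delV // xd invg1.
Qed.

Lemma strand_ker_fix p x : strand_ker p x -> strand_fix p x -> x = 1.
Proof. by move=> [_ <-] [_ ->]. Qed.

(** A kernel is normal in the domain of its homomorphism, here the stabilizer of [p]. *)
Lemma strand_fix_normalizer p : strand_fix p `<=` normalizer (strand_ker p).
Proof.
have main x y : braid_pos x p = p -> strand_ker p y -> strand_ker p (y ^ x).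
  move=> xp [yp yd]; rewrite /strand_ker /= conjgE !braid_posM !braid_delM.
  by rewrite !(braid_posV xp) yp xp yd mul1g braid_delV // mulVg.
by move=> x [xp _] y ky; split; apply: main => //; exact: braid_posV.
Qed.

End StrandDeletion.

Arguments strand_ker m o p : clear implicits.
Arguments strand_fix m o p : clear implicits.

(** * Pure braid generators *)

Section PureBraids.
Variable m : nat.
Implicit Types (A H : set (braid m)) (i j k l p : nat).

Lemma strand_fix_left i p : (0 < i)%N -> (i.+1 < p <= m)%N ->
  strand_fix m 0 p (sigma m i).
Proof.
move=> i0 ip; split; first by rewrite braid_pos_sigma ?swap_pos_out //; lia.
by rewrite braid_del_sigma ?sigma_del_right ?addn0 //; lia.
Qed.

Lemma strand_fix_right i p : (0 < p < i)%N -> (i < m)%N ->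
  strand_fix m 1 p (sigma m i).
Proof.
move=> pi im; split; first by rewrite braid_pos_sigma ?swap_pos_out //; lia.
by rewrite braid_del_sigma ?sigma_del_left ?addn1 ?prednK //; lia.
Qed.

(** After the first crossing the strand sits in the other of the positions [i], [i.+1], so both
    crossings of the full twist involve it. *)
Lemma strand_ker_sigma2 o i p : (o <= 1)%N -> (0 < i < m)%N ->
  (i <= p <= i.+1)%N -> strand_ker m o p (sigma m i ^+ 2).
Proof.
move=> o1 im ip; rewrite /strand_ker /= expg2 braid_posM // braid_delM //.
rewrite !braid_pos_sigma ?swap_posK // !braid_del_sigma ?sigma_del_swap //.
by rewrite sigma_del_mid ?mulg1 //; lia.
Qed.

(** Induction on [p - l] from the full twist: lowering [l] conjugates by a crossing to the left of
    strand [p], which normalizes the kernel. *)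
Lemma apure_strand_ker_left l p : (0 < l < p)%N -> (p <= m)%N ->
  strand_ker m 0 p (apure m l p).
Proof.
move=> lp pm; have [d dE] : exists d, (p = l + d.+1)%N by exists (p - l.+1)%N; lia.
elim: d l lp dE => [|d IH] l lp dE.
  have -> : p = l.+1 by lia.
  by rewrite apure0; apply: strand_ker_sigma2; lia.
rewrite apure_low; try lia.
have [] := @strand_fix_normalizer m 0 _ p (sigma m l) _ _ (IH l.+1 _ _); try lia.
  by apply: strand_fix_left; lia.
by [].
Qed.

Lemma apure_strand_ker_right p j : (0 < p < j)%N -> (j <= m)%N ->
  strand_ker m 1 p (apure m p j).
Proof.
move=> /andP[p0]; elim: j => // j IH; rewrite ltnS leq_eqVlt => /predU1P[<-|pj] jm.
  by rewrite apure0; apply: strand_ker_sigma2; lia.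
rewrite apureS //.
have [] // := @strand_fix_normalizer m 1 _ p (sigma m j) _ _ (IH _ _); try lia.
by apply: strand_fix_right; lia.
Qed.

Lemma apure_sub H l j : subgroup H -> (0 < l < j)%N ->
  (forall i, (l <= i < j)%N -> H (sigma m i)) -> H (apure m l j).
Proof.
move=> sH /andP[l0]; elim: j => // j IH; rewrite ltnS leq_eqVlt => /predU1P[<-|lj] HS.
  by rewrite apure0; apply: subgroupX => //; apply: HS; lia.
rewrite apureS //; apply: subgroupJ => //; last by apply: subgroupV => //; apply: HS; lia.
by apply: IH => // i ij; apply: HS; lia.
Qed.

(** * Conjugation of the pure generators by the standard generators *)

Lemma apure_conj_up l j : (l < j)%N -> apure m l j.+1 ^ sigma m j = apure m l j.
Proof. by move=> lj; rewrite apureS // conjgKV. Qed.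

Lemma commute_conjg (x y : braid m) : commute x y -> x ^ y = x.
Proof. by move=> /commgP/conjg_fixP. Qed.

(** Strand [k] encircles strands [i] and [i.+1] together, so their crossing slides through. For
    [k = i.+2] the product is [t * s * s * t]; larger [k] arise by conjugating with crossings far
    from [sigma m i]. *)
Lemma apure_prod_low i k : (0 < i)%N -> (i.+1 < k <= m)%N ->
  commute (apure m i k * apure m i.+1 k) (sigma m i).
Proof.
move=> i0; elim: k => // k IH /andP[]; rewrite ltnS leq_eqVlt.
move=> /predU1P[<-|ik] km; last first.
  have kC : commute (sigma m k)^-1 (sigma m i) by apply/commuteVl/sigma_far; lia.
  by rewrite !apureS -?conjMg; try lia; apply: commuteJ kC; apply: IH; lia.
rewrite apureS // !apure0 !expg2 conjgE invgK.
have := sigma_adj i0 km; set s := sigma m i; set t := sigma m i.+1 => E.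
have -> : t * (s * s / t) * (t * t) = t * s * (s * t) by rewrite !mulgA mulgVK.
have E1 : t * s * (s * t) * s = t * s * (t * s * t) by rewrite -E !mulgA.
by rewrite /commute E1 mulgA [t * s * (t * s)]mulgA -E !mulgA.
Qed.

(** With [b = apure m k j] and [s = sigma m j] the product is [b * s * b * s^-1]; multiplied by [s],
    the claim becomes [apure_braid4]. *)
Lemma apure_prod_high k j : (0 < k < j)%N -> (j < m)%N ->
  commute (apure m k j * apure m k j.+1) (sigma m j).
Proof.
move=> kj jm; rewrite apureS ?conjgE ?invgK; last lia.
have := apure_braid4 kj jm; set b := apure m k j; set s := sigma m j.
rewrite /commute => E; apply: (mulIg s).
by rewrite !mulgA !mulgVK; move: E; rewrite !mulgA => ->.
Qed.

(** For [y = x ^ s], invariance of [y * x] under [s] and [s^-1] gives [y ^ s = y * x * y^-1] and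
    [x ^ s^-1 = x^-1 * y * x]. *)
Lemma conj_closed_of_commute_prod H (x s : braid m) : subgroup H -> H x -> H (x ^ s) ->
    commute (x ^ s * x) s ->
  H ((x ^ s) ^ s) /\ H (x ^ s^-1).
Proof.
move=> sH Hx; set y := x ^ s => Hy cyx.
have yE : y ^ s = y * x * y^-1.
  by have := commute_conjg cyx; rewrite conjMg -/y => <-; rewrite mulgK.
have xE : x ^ s^-1 = x^-1 * y * x.
  have := commute_conjg (commuteV cyx); rewrite conjMg /y conjgK -/y => E.
  by rewrite -[LHS](mulKg x) E mulgA.
have [Vx Vy] := (subgroupV sH Hx, subgroupV sH Hy).
rewrite yE xE; split; apply: (subgroupM sH) => //; exact: (subgroupM sH).
Qed.

Lemma apure_conj_low H i k : subgroup H -> (0 < i)%N -> (i.+1 < k <= m)%N ->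
    H (apure m i k) -> H (apure m i.+1 k) -> forall l, l = i \/ l = i.+1 ->
  H (apure m l k ^ sigma m i) /\ H (apure m l k ^ (sigma m i)^-1).
Proof.
move=> sH i0 ik Hi Hi1; have E := apure_low i0 ik.
have [] := @conj_closed_of_commute_prod H (apure m i.+1 k) (sigma m i); rewrite -?E //.
  exact: apure_prod_low.
by move=> H1 H2 l [->|->]; split=> //; rewrite ?E ?conjgK -?E.
Qed.

Lemma apure_conj_high H l j : subgroup H -> (0 < l < j)%N -> (j < m)%N ->
    H (apure m l j) -> H (apure m l j.+1) -> forall k, k = j \/ k = j.+1 ->
  H (apure m l k ^ sigma m j) /\ H (apure m l k ^ (sigma m j)^-1).
Proof.
move=> sH lj jm Hj Hj1.
have E : apure m l j = apure m l j.+1 ^ sigma m j by rewrite apure_conj_up //; lia.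
have [] := @conj_closed_of_commute_prod H (apure m l j.+1) (sigma m j); rewrite -?E //.
  exact: apure_prod_high.
by move=> H1 H2 k [->|->]; split=> //; rewrite ?E ?conjgK -?E.
Qed.

(** In these configurations the two braids commute; all others fall under [apure_conj_low] or
    [apure_conj_high]. *)
Lemma apure_conj_fix H l j i : (0 < l < j)%N -> (j <= m)%N -> (0 < i)%N ->
    [|| i.+1 < l, (l < i)%N && (i.+1 < j), j < i | (l == i)%N && (j == i.+1)]%N ->
    H (apure m l j) ->
  H (apure m l j ^ sigma m i) /\ H (apure m l j ^ (sigma m i)^-1).
Proof.
move=> lj jm i0 h Ha; have c : commute (apure m l j) (sigma m i).
  case/or4P: h => [h|h|h|/andP[/eqP-> /eqP->]]; try by apply: apure_far; lia.
    by apply: apure_mid; lia.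
  by rewrite apure0; exact/commute_sym/commuteX/commute_refl.
by rewrite !commute_conjg //; exact: commuteV.
Qed.

End PureBraids.

(** * Handlebody braids *)

Section HandlebodyBraids.
Variables g n : nat.
Local Notation B := (braid (g + n)).
Local Notation a := (apure (g + n)).
Local Notation s := (sigma (g + n)).
Implicit Types (H : set B) (i j k l : nat).

Lemma sigma_normalizer_U k i : (0 < i)%N -> (i.+1 < k <= g + n)%N ->
  normalizer (U g n k) (s i).
Proof.
move=> i0 ik; apply: normalizer_generated => _ [l /= lk <-]; rewrite -/(U g n k).
have sU : subgroup (U g n k) by exact: generated_subgroup.
have Ul j : (1 <= j < k)%N -> U g n k (a j k).
  by move=> jk; apply: sub_generated; exists j.
have [h|h] := boolP ((l == i) || (l == i.+1)).
  by apply: apure_conj_low => //; try (apply: Ul); lia.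
by apply: apure_conj_fix; try lia; exact: Ul.
Qed.

Lemma sigma_normalizer_V k i : (0 < k < i)%N -> (i < g + n)%N ->
  normalizer (V g n k) (s i).
Proof.
move=> ki im; apply: normalizer_generated => _ [j /= kj <-]; rewrite -/(V g n k).
have sV : subgroup (V g n k) by exact: generated_subgroup.
have Vl l : (k < l <= g + n)%N -> V g n k (a k l).
  by move=> kl; apply: sub_generated; exists l.
have [h|h] := boolP ((j == i) || (j == i.+1)).
  by apply: apure_conj_high => //; try (apply: Vl); lia.
by apply: apure_conj_fix; try lia; exact: Vl.
Qed.

(* P(lo, hi); P(1, g + n) consists of the pure braids of the handlebody. *)
Definition pure_between lo hi : set B :=
  generated [set a ij.1 ij.2 | ij in
    [set ij | [&& lo <= ij.1, ij.1 < ij.2, g < ij.2 & ij.2 <= hi]%N]].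

Lemma pure_between_subgroup lo hi : subgroup (pure_between lo hi).
Proof. exact: generated_subgroup. Qed.

Lemma mem_pure_between lo hi l j :
  (lo <= l < j)%N -> (g < j <= hi)%N -> pure_between lo hi (a l j).
Proof. by move=> *; apply: sub_generated; exists (l, j) => //=; lia. Qed.

Lemma pure_between_min lo hi H : subgroup H ->
    (forall l j, (lo <= l < j)%N -> (g < j <= hi)%N -> H (a l j)) ->
  pure_between lo hi `<=` H.
Proof.
move=> sH Ha; apply: generated_min => // _ [[l j] /= lj <-]; apply: Ha; lia.
Qed.

Lemma pure_between_mono lo lo' hi hi' : (lo' <= lo)%N -> (hi <= hi')%N ->
  pure_between lo hi `<=` pure_between lo' hi'.
Proof.
move=> *; apply: pure_between_min; first exact: pure_between_subgroup.
by move=> *; apply: mem_pure_between; lia.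
Qed.

Lemma PtildeE : Ptilde g n = pure_between g.+1 (g + n).
Proof.
by congr generated; congr image; apply/seteqP; split=> -[i j] /=; lia.
Qed.

Lemma pure_between_VgE i : (i <= g.+1)%N ->
  generated ((\bigcup_(j in [set j | i <= j <= g]%N) Vg g n j) `|` Ptilde g n) =
  pure_between i (g + n).
Proof.
move=> ig; rewrite PtildeE; apply/seteqP; split.
  apply: generated_min; first exact: pure_between_subgroup.
  move=> x [[l /= il]|]; last by apply: pure_between_mono.
  apply: generated_min x; first exact: pure_between_subgroup.
  by move=> _ [j /= gj <-]; apply: mem_pure_between; lia.
apply: pure_between_min; first exact: generated_subgroup.
move=> l j lj gj; apply: sub_generated; have [lg|lg] := leqP l g.
  by left; exists l => /=; [lia|apply: sub_generated; exists j].
by right; apply: mem_pure_between; lia.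
Qed.

(** As [lo <= g.+1 <= i] and [i.+1 <= g + n], exchanging [i] and [i.+1] respects the bounds on both
    indices of a generator. *)
Lemma sigma_normalizer_pure_between lo i : (0 < lo <= g.+1)%N -> (g < i < g + n)%N ->
  normalizer (pure_between lo (g + n)) (s i).
Proof.
move=> lo0 gi; apply: normalizer_generated => _ [[l j] /= lj <-].
rewrite -/(pure_between lo (g + n)).
have sP := pure_between_subgroup lo (g + n).
have [h|h] := boolP [&& i.+1 < j & (l == i) || (l == i.+1)]%N.
  have [ij /orP li] := andP h.
  apply: apure_conj_low => //; try (apply: mem_pure_between; lia); try lia.
have [h'|h'] := boolP [&& l < i & (j == i) || (j == i.+1)]%N.
  have [il /orP ji] := andP h'.
  apply: apure_conj_high => //; try (apply: mem_pure_between; lia); try lia.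
by apply: apure_conj_fix; try lia; apply: mem_pure_between; lia.
Qed.

(** * The kernel [R] inside the handlebody braids *)

Lemma hb_embed_range_subgroup : subgroup (range (@hb_embed g n)).
Proof. by rewrite hb_embed_range; exact: generated_subgroup. Qed.

Lemma hb_embed_range_sigma i : (g < i < g + n)%N -> range (@hb_embed g n) (s i).
Proof. by move=> gi; rewrite hb_embed_range; apply: sub_generated; right; exists i. Qed.

Lemma hb_phi1 : @hb_phi g n 1 = 1. Proof. exact: gmulf1. Qed.

Lemma hb_phiM (x y : hb_braid g n) : hb_phi (x * y) = hb_phi x * hb_phi y.
Proof. exact: gmulfM. Qed.

Lemma hb_phiV (x : hb_braid g n) : hb_phi x^-1 = (hb_phi x)^-1.
Proof. exact: gmulfV. Qed.

Lemma R_subgroup : subgroup (R g n).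
Proof.
split=> [|_ _ [x /= px <-] [y /= py <-]|_ [x /= px <-]].
- by exists 1; [exact: hb_phi1 | exact: gmulf1].
- by exists (x * y); [rewrite /= hb_phiM px py mulg1 | exact: gmulfM].
- by exists x^-1; [rewrite /= hb_phiV px invg1 | exact: gmulfV].
Qed.

Lemma hb_embed_range_normalizer_R : range (@hb_embed g n) `<=` normalizer (R g n).
Proof.
have main y x : R g n x -> R g n (x ^ hb_embed y).
  case=> z /= pz <-; exists (z ^ y); last exact: gmulfJ.
  by rewrite /= conjgE !hb_phiM pz mul1g hb_phiV mulVg.
move=> _ [y _ <-] x Rx; split; first exact: main.
by rewrite -[(hb_embed y)^-1](gmulfV (@hb_embed g n)); exact: main.
Qed.

(** For [j = g.+1] this is [tau_l], which [hb_phi] kills; larger [j] follow by conjugating with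
    handlebody braids. *)
Lemma R_apure l j : (0 < l <= g)%N -> (g < j <= g + n)%N -> R g n (a l j).
Proof.
move=> lg; elim: j => // j IH /andP[]; rewrite ltnS leq_eqVlt => /predU1P[<-|gj] jm.
  have h : (1 <= l < g.+1)%N by lia.
  exists (pres_gen _ (inl (Sub l h))) => /=.
    exact: (pres_lift_gen (@hb_phi_respects g n)).
  exact: (pres_lift_gen (@hb_embed_respects g n)).
rewrite apureS; last lia.
have Ms : range (@hb_embed g n) (s j) by apply: hb_embed_range_sigma; lia.
have Rj : R g n (a l j) by apply: IH; lia.
by have [] := hb_embed_range_normalizer_R Ms Rj.
Qed.

Lemma hb_embed_range_pure lo hi : (0 < lo)%N -> (hi <= g + n)%N ->
  pure_between lo hi `<=` range (@hb_embed g n).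
Proof.
move=> lo0 him; have sM := hb_embed_range_subgroup.
apply: pure_between_min => // l j lj gj; have [lg|lg] := leqP l g.
  by have [||x _ <-] := @R_apure l j; try lia; exists x.
apply: apure_sub => //; first lia.
by move=> i ij; apply: hb_embed_range_sigma; lia.
Qed.

Lemma pure_between_normalizer_R lo hi : (0 < lo)%N -> (hi <= g + n)%N ->
  pure_between lo hi `<=` normalizer (R g n).
Proof.
by move=> lo0 him x /(hb_embed_range_pure lo0 him); exact: hb_embed_range_normalizer_R.
Qed.

(** Induction on words shows that the value under [hb_embed] times the inverse of the value under
    [hb_phi] is in [pure_between 1 (g + n)]: a letter [tau_k] multiplies this quotient by a
    generator or its inverse, a letter [sigma_i] conjugates it. On [R] the second factor is 1. *)
Lemma R_sub_pure : (0 < n)%N -> R g n `<=` pure_between 1 (g + n).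
Proof.
have sP := pure_between_subgroup 1 (g + n).
move=> n0 _ [y /= py <-]; rewrite -[hb_embed y]mulg1 -[1 in X in _ X]invg1 -py.
rewrite /hb_embed /hb_phi /pres_lift; elim: (pres_repr y) => [|[[k|i] b] w IH].
- by rewrite /word_eval !big_nil invg1 mulg1; exact: subgroup1.
- rewrite /word_eval !big_cons -!/(word_eval _ _) invgM -!mulgA.
  rewrite [X in _ * (_ * (_ * X))](_ : _ = 1) ?mulg1; last first.
    by rewrite /letter_eval /=; case: b; rewrite ?invg1.
  have /= kg := valP k; have Pk : pure_between 1 (g + n) (a (val k) g.+1).
    by apply: mem_pure_between => /=; lia.
  apply: (subgroupM sP) => //.
  by rewrite /letter_eval; case: b => //=; exact: (subgroupV sP).
- rewrite /word_eval !big_cons -!/(word_eval _ _) invgM.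
  set x := letter_eval _ _; have -> : letter_eval (@hb_phi_gen g n) (inr i, b) = x by [].
  have Nx : normalizer (pure_between 1 (g + n)) x.
    have /= ig := valP i; rewrite /x /letter_eval /=.
    have Ni : normalizer (pure_between 1 (g + n)) (s (val i)).
      by apply: sigma_normalizer_pure_between => /=; lia.
    by case: b {x} => //; apply: subgroupV Ni; exact: normalizer_subgroup.
  have [_] := Nx _ IH.
  by rewrite conjgE invgK !mulgA.
Qed.

(* [partial_phi_gen d] kills tau_1, ..., tau_d; deleting strand d + 1 turns it
   into [partial_phi_gen d.+1], thus leads from hb_embed to hb_phi. *)
Definition partial_phi_gen d (x : hb_idx g n) : B :=
  match x with
  | inl k => if (val k <= d)%N then 1 else a (val k) g.+1
  | inr i => s (val i)
  end.

Lemma pure_between_fix p lo : (0 < p < lo)%N -> (p <= g)%N ->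
  pure_between lo (g + n) `<=` strand_fix (g + n) 1 p.
Proof.
move=> p0 pg; have sF : subgroup (strand_fix (g + n) 1 p) by exact: strand_fix_subgroup.
apply: pure_between_min => // l j lj gj; apply: apure_sub => //; first lia.
by move=> i ij; apply: strand_fix_right; lia.
Qed.

(** The generators with first index [p] lie in the kernel; the others are fixed by the deletion. *)
Lemma pure_between_ker p : (0 < p <= g)%N ->
  pure_between p (g + n) `<=` normalizer (strand_ker (g + n) 1 p).
Proof.
move=> p0; have sK : subgroup (strand_ker (g + n) 1 p) by exact: strand_ker_subgroup.
apply: pure_between_min; first exact: normalizer_subgroup.
move=> l j lj gj; have [->|lp] := eqVneq l p.
  by apply: (subgroup_normalizer sK); apply: apure_strand_ker_right; lia.
apply: strand_fix_normalizer => //; apply: (@pure_between_fix p p.+1); try lia.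
by apply: mem_pure_between; lia.
Qed.

Lemma partial_phi_genP d x : (d < g)%N -> (0 < n)%N ->
  braid_pos (partial_phi_gen d x) d.+1 = d.+1 /\
  braid_del 1 (partial_phi_gen d x) d.+1 = partial_phi_gen d.+1 x.
Proof.
move=> dg n0; case: x => [k|i] /=.
  have /= kg := valP k; have [kd|kd] := leqP (sval k) d.
    by rewrite ifT ?braid_pos1 ?braid_del1 //; lia.
  have [->|kN] := eqVneq (sval k) d.+1.
    by rewrite leqnn; apply: apure_strand_ker_right; lia.
  rewrite ifF; last by apply/negbTE; lia.
  apply: (@pure_between_fix d.+1 d.+2); try lia.
  by apply: mem_pure_between => /=; lia.
have /= ig := valP i; apply: strand_fix_right => /=; lia.
Qed.

(** Each generator keeps strand [d.+1] in position, so deletion is multiplicative along [w]. Working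
    with words avoids checking the handlebody relations for the intermediate maps. *)
Lemma word_eval_partial_phi d w : (d < g)%N -> (0 < n)%N ->
  braid_pos (word_eval (partial_phi_gen d) w) d.+1 = d.+1 /\
  braid_del 1 (word_eval (partial_phi_gen d) w) d.+1 =
    word_eval (partial_phi_gen d.+1) w.
Proof.
move=> dg n0; elim: w => [|[x b] w [IHp IHd]].
  by rewrite /word_eval !big_nil braid_pos1 braid_del1.
have [xp xd] := partial_phi_genP x dg n0.
have [yp yd] : braid_pos (letter_eval (partial_phi_gen d) (x, b)) d.+1 = d.+1 /\
    braid_del 1 (letter_eval (partial_phi_gen d) (x, b)) d.+1 =
    letter_eval (partial_phi_gen d.+1) (x, b).
  by rewrite /letter_eval; case: b => //=; rewrite braid_posV // braid_delV // xd.
rewrite /word_eval !big_cons -!/(word_eval _ _).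
by rewrite braid_posM braid_delM // yp yd IHp IHd.
Qed.

Lemma R_Ptilde x : (0 < n)%N -> R g n x -> Ptilde g n x -> x = 1.
Proof.
move=> n0 [y /= py <-]; rewrite PtildeE => Px.
have gen0 : @hb_embed_gen g n = partial_phi_gen 0.
  apply/funext => -[k|i] //=; rewrite ifF //; have /= := valP k; lia.
have geng : @hb_phi_gen g n = partial_phi_gen g.
  apply/funext => -[k|i] //=; rewrite ifT //; have /= := valP k; lia.
(* Deleting strand [d.+1] fixes [hb_embed y], which lies in [Ptilde], while it turns the value for
   [d] into that for [d.+1]; at [d = g] the value is [hb_phi y = 1]. *)
suff : forall d, (d <= g)%N -> word_eval (partial_phi_gen d) (pres_repr y) = hb_embed y.
  by move=> /(_ g (leqnn g)); rewrite -geng => <-.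
elim=> [|d IH] dg; first by rewrite -gen0.
have [_ <-] := word_eval_partial_phi (pres_repr y) dg n0.
rewrite IH ?(ltnW dg) //; apply: (@pure_between_fix d.+1 g.+1 _ _ _ Px).2; lia.
Qed.

(** * The individual semidirect products and the two chains *)

Lemma VbarE i : (i <= g)%N ->
  Vbar g n i = normal_closure (pure_between i (g + n)) (Vg g n i).
Proof. by move=> ig; rewrite /Vbar pure_between_VgE //; lia. Qed.

Lemma semidirect_Vbar i : (0 < i <= g)%N ->
  semidirect (Vbar g n i) (R g n `&` pure_between i.+1 (g + n))
    (R g n `&` pure_between i (g + n)).
Proof.
move=> ig; have sR := R_subgroup; have i0 : (0 < i)%N by lia.
have sP k := pure_between_subgroup k (g + n).
have sVP : Vg g n i `<=` pure_between i (g + n).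
  by apply: generated_min => // _ [j /= gj <-]; apply: mem_pure_between; lia.
have PP : pure_between i.+1 (g + n) `<=` pure_between i (g + n).
  by apply: pure_between_mono.
have nV := normal_closure_normal (sP i) sVP.
rewrite -VbarE in nV; last lia.
have VNV := normal_in_normalizer (sP i) nV; have [sV VP _] := nV.
(* [normal_in] demands inclusion in the ambient group, so [N] is first intersected with it. This is
   applied to [R] and to the kernel of deleting strand [i]. *)
have closure_sub N : subgroup N -> pure_between i (g + n) `<=` normalizer N ->
    (forall j, (g < j <= g + n)%N -> N (a i j)) -> Vbar g n i `<=` N.
  move=> sN PN Na; have sNP := subgroupI sN (sP i).
  rewrite VbarE; last lia.
  apply: (subset_trans (B := N `&` pure_between i (g + n))); last by move=> x [].
  apply: normal_closure_min.
    apply: normal_inP => // x Px.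
    by apply: normalizerI; split; [exact: PN | exact: subgroup_normalizer].
  apply: generated_min => // _ [j /= gj <-].
  by split; [exact: Na | apply: mem_pure_between; lia].
have VR : Vbar g n i `<=` R g n.
  apply: closure_sub => //; first by apply: pure_between_normalizer_R; lia.
  by move=> j gj; apply: R_apure; lia.
have VK : Vbar g n i `<=` strand_ker (g + n) 1 i.
  apply: closure_sub; [exact: strand_ker_subgroup | exact: pure_between_ker |].
  by move=> j gj; apply: apure_strand_ker_right; lia.
split.
- apply: normal_inP => // x; first by move=> Vx; split; [exact: VR | exact: VP].
  by case=> _ Px; exact: VNV.
- by split; [exact: subgroupI | move=> x [Rx /PP]].
- apply/seteqP; split=> [x [Vx [_ Px]]|_ ->].
    apply: (strand_ker_fix (VK x Vx)); apply: pure_between_fix Px; lia.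
  by split; [exact: subgroup1 | split; exact: subgroup1].
apply/seteqP; split=> [_ [x Vx [y [Ry Py] <-]]|x [Rx Px]].
  split; first exact: (subgroupM sR (VR x Vx) Ry).
  exact: (subgroupM (sP i) (VP x Vx) (PP y Py)).
have [||||y Vy [z Pz yz]] := generated_sub_mulset (N := Vbar g n i)
    (H := pure_between i.+1 (g + n)) _ _ _ _ Px => //.
- by move=> z /PP; exact: VNV.
- move=> _ [[l j] /= lj <-]; have [->|li] := eqVneq l i.
    left; rewrite VbarE; last lia.
    by apply: sub_normal_closure; apply: sub_generated; exists j => //=; lia.
  by right; apply: mem_pure_between; lia.
exists y => //; exists z => //; split=> //.
have -> : z = y^-1 * x by rewrite -yz mulKg.
by apply: (subgroupM sR) => //; apply: (subgroupV sR); exact: VR.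
Qed.

Lemma semidirect_Ubar k : (0 < k <= n)%N ->
  semidirect (Ubar g n k) (R g n `&` pure_between 1 (g + k.-1))
    (R g n `&` pure_between 1 (g + k)).
Proof.
move=> kn; have sR := R_subgroup; have n0 : (0 < n)%N by lia.
have sP lo hi := pure_between_subgroup lo hi.
have sU : subgroup (U g n (g + k)) by exact: generated_subgroup.
have PP lo : pure_between lo (g + k.-1) `<=` pure_between lo (g + k).
  by apply: pure_between_mono; lia.
have UP : U g n (g + k) `<=` pure_between 1 (g + k).
  by apply: generated_min => // _ [l /= lk <-]; apply: mem_pure_between; lia.
have PR lo j : (0 < lo)%N -> (j <= k)%N ->
    pure_between lo (g + j) `<=` normalizer (R g n).
  by move=> *; apply: pure_between_normalizer_R; lia.
have P'U : pure_between 1 (g + k.-1) `<=` normalizer (U g n (g + k)).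
  have sN := normalizer_subgroup (U g n (g + k)).
  apply: pure_between_min => // l j lj gj; apply: (apure_sub sN); first lia.
  by move=> i ij; apply: sigma_normalizer_U; lia.
have PU : pure_between 1 (g + k) `<=` normalizer (U g n (g + k)).
  apply: pure_between_min; first exact: normalizer_subgroup.
  move=> l j lj gj; have [jE|jN] := eqVneq j (g + k)%N.
    apply: (subgroup_normalizer sU); apply: sub_generated; exists l; rewrite ?jE //=; lia.
  by apply: P'U; apply: mem_pure_between; lia.
have UgU : Ug g n k `<=` U g n (g + k).
  by apply: generated_mono => _ [l /= lg <-]; exists l => //=; lia.
have nUbar := normal_closure_normal sU UgU; rewrite -/(Ubar g n k) in nUbar.
have [sUbar UbarU _] := nUbar.
have UbarR : Ubar g n k `<=` R g n.
  apply: (subset_trans (B := U g n (g + k) `&` R g n)); last by move=> x [].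
  apply: normal_closure_min.
    apply: normal_inP => //; [exact: subgroupI | move=> x Ux].
    apply: normalizerI; split; first exact: subgroup_normalizer.
    by apply: PR (UP x Ux); lia.
  apply: generated_min; first exact: subgroupI.
  move=> _ [l /= lg <-]; split; last by apply: R_apure; lia.
  by apply: sub_generated; exists l => //=; lia.
(* [Q] receives the generators of [U] with first index above [g], giving [U = Ubar * Q]; [Q] meets
   [R] trivially, whence [Ubar] is the intersection of [U] and [R]. This form shows that [Ubar],
   defined as a normal closure in [U] only, is normalized by the larger pure group. *)
pose Q := U g n (g + k) `&` pure_between g.+1 (g + k).
have sQ : subgroup Q by exact: subgroupI.
have UE u : U g n (g + k) u -> mulset (Ubar g n k) Q u.
  apply: generated_sub_mulset => //.
    by move=> x [Ux _]; exact: (normal_in_normalizer sU nUbar).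
  move=> _ [l /= lk <-]; have [lg|lg] := leqP l g.
    left; apply: sub_normal_closure; apply: sub_generated; exists l => //=; lia.
  right; split; first by apply: sub_generated; exists l.
  by apply: mem_pure_between; lia.
have Ptilde1 x : R g n x -> pure_between g.+1 (g + k) x -> x = 1.
  move=> Rx Px; apply: R_Ptilde => //; rewrite PtildeE.
  by apply: pure_between_mono Px; lia.
have UbarE : Ubar g n k = U g n (g + k) `&` R g n.
  apply/seteqP; split=> [x Ux|x [/UE[y Uy [z [_ Pz] <-]] Rx]].
    by split; [exact: UbarU | exact: UbarR].
  rewrite (Ptilde1 z) ?mulg1 //.
  have -> : z = y^-1 * (y * z) by rewrite mulKg.
  by apply: (subgroupM sR) => //; apply: (subgroupV sR); exact: UbarR.
have U1 x : U g n (g + k) x -> pure_between 1 (g + k.-1) x -> x = 1.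
  move=> Ux Px; apply: (@strand_ker_fix (g + n) 0 (g + k)).
    apply: (generated_min _ _ Ux); first exact: strand_ker_subgroup.
    by move=> _ [l /= lk <-]; apply: apure_strand_ker_left; lia.
  have sF : subgroup (strand_fix (g + n) 0 (g + k)) by exact: strand_fix_subgroup.
  apply: (pure_between_min sF _ Px) => l j lj gj; apply: (apure_sub sF); first lia.
  by move=> i ij; apply: strand_fix_left; lia.
split.
- apply: normal_inP => // x.
    by move=> Ux; split; [exact: UbarR | exact: (UP x (UbarU x Ux))].
  case=> _ Px; rewrite UbarE; apply: normalizerI; split; first exact: PU.
  by apply: PR Px.
- by split; [exact: subgroupI | move=> x [Rx /PP]].
- apply/seteqP; split=> [x [/UbarU Ux [_ Px]]|_ ->]; first exact: U1.
  by split; [exact: subgroup1 | split; exact: subgroup1].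
apply/seteqP; split=> [_ [x Ux [y [Ry Py] <-]]|x [Rx Px]].
  split; first exact: (subgroupM sR (UbarR x Ux) Ry).
  exact: (subgroupM (sP _ _) (UP x (UbarU x Ux)) (PP _ y Py)).
(* The factor [u] of [x = u * y] need not lie in [R] a priori. Writing [y = r * q] and [u = b * v],
   with [r] in [R], [b] in [Ubar] and [q], [v] in [Ptilde], isolates the obstruction [v * q]. *)
have [||||u Uu [y Py uy]] := generated_sub_mulset (N := U g n (g + k))
    (H := pure_between 1 (g + k.-1)) _ _ _ _ Px => //.
  move=> _ [[l j] /= lj <-]; have [jE|jN] := eqVneq j (g + k)%N.
    by left; apply: sub_generated; exists l; rewrite ?jE //=; lia.
  by right; apply: mem_pure_between; lia.
have [||||r Rr [q Pq rq]] := generated_sub_mulset (N := R g n)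
    (H := pure_between g.+1 (g + k.-1)) _ _ _ _ Py => //.
- by apply: PR; lia.
- move=> _ [[l j] /= lj <-]; have [lg|lg] := leqP l g.
    by left; apply: R_apure; lia.
  by right; apply: mem_pure_between; lia.
have [b Ub [v [Uv Pv] bv]] := UE u Uu.
have vq1 : v * q = 1.
  apply: Ptilde1; last exact: (subgroupM (sP _ _) Pv (PP _ q Pq)).
  (* From [b^-1 * x = v * r * q], moving [r] to the left past [v] exhibits [v * q] as an element of
     [R]. *)
  have -> : v * q = (r ^ v^-1)^-1 * (b^-1 * x).
    by rewrite -uy -bv -rq conjgE invgK -!mulgA mulKg !invgM !invgK !mulgA !mulgVK.
  apply: (subgroupM sR).
    apply: (subgroupV sR); by have [] := PR g.+1 k (ltn0Sn g) (leqnn k) v Pv r Rr.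
  by apply: (subgroupM sR) => //; apply: (subgroupV sR); exact: UbarR.
(* Now [v = q^-1] lies both in [U] and in the braids on the first [g + k - 1] strings. *)
have v1 : v = 1.
  have vE : v = q^-1 by rewrite -[LHS](mulgK q) vq1 mul1g.
  apply: U1 => //; rewrite vE; apply: (subgroupV (sP _ _)).
  by apply: pure_between_mono Pq; lia.
exists b => //; exists y; last by rewrite -uy -bv v1 mulg1.
split=> //; have -> : y = b^-1 * x by rewrite -uy -bv v1 mulg1 mulKg.
by apply: (subgroupM sR) => //; apply: (subgroupV sR); exact: UbarR.
Qed.

Lemma iter_semidirect_Ubar k : (k <= n)%N ->
  iter_semidirect [seq Ubar g n i | i <- rev (iota 1 k)]
    (R g n `&` pure_between 1 (g + k)).
Proof.
elim: k => [|k IH] kn; last first.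
  rewrite -[X in iota _ X]addn1 iotaD rev_cat map_cat /= add1n.
  apply: iter_semidirect_cons (IH (ltnW kn)) _.
  by apply: (semidirect_Ubar (k := k.+1)); lia.
apply/seteqP; split=> [x [_ Px]|_ ->].
  (* No [j] satisfies [g < j <= g + 0], so the generating family is empty. *)
  apply: (@pure_between_min 1 (g + 0) [set 1] _ _ x Px) => [|l j]; last lia.
  by split=> [//|_ _ -> ->|_ ->]; rewrite /= ?mulg1 ?invg1.
split; first exact: (subgroup1 R_subgroup).
exact: (subgroup1 (pure_between_subgroup _ _)).
Qed.

(** Induction on the number [d] of remaining factors; the empty chain, at [i = g.+1], is the trivial
    intersection of [R] with [Ptilde]. *)
Lemma iter_semidirect_Vbar d i : (0 < n)%N -> (0 < i)%N -> (i + d = g.+1)%N ->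
  iter_semidirect [seq Vbar g n j | j <- iota i d]
    (R g n `&` pure_between i (g + n)).
Proof.
move=> n0; elim: d i => [|d IH] i i0 iE.
  rewrite (_ : i = g.+1) -?PtildeE; last lia.
  apply/seteqP; split=> [x [Rx Px]|_ ->]; first exact: R_Ptilde.
  by split; [exact: (subgroup1 R_subgroup) | exact: (subgroup1 (generated_subgroup _))].
apply: iter_semidirect_cons (IH i.+1 _ _) _; try lia.
by apply: semidirect_Vbar; lia.
Qed.

Lemma Ubar1E : Ubar g n 1 = U g n g.+1.
Proof.
rewrite /Ubar (_ : Ug g n 1 = U g n (g + 1)); last first.
  by congr generated; congr image; apply/seteqP; split=> l /=; lia.
rewrite normal_closure_id ?addn1 //.
apply: normal_inP => //; [exact: generated_subgroup|].
by apply: subgroup_normalizer; exact: generated_subgroup.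
Qed.

(** [V g n g] is already normal in the ambient group: the generators outside it are words in the
    [sigma_i] with [i > g], which normalize it. *)
Lemma VbargE : (0 < g)%N -> Vbar g n g = V g n g.
Proof.
move=> g0; rewrite VbarE // -/(V g n g).
have sV : subgroup (V g n g) by exact: generated_subgroup.
apply: normal_closure_id; apply: normal_inP => //.
  apply: generated_min; first exact: pure_between_subgroup.
  by move=> _ [j /= gj <-]; apply: mem_pure_between; lia.
apply: pure_between_min; first exact: normalizer_subgroup.
move=> l j lj gj; have [->|lg] := eqVneq l g.
  by apply: subgroup_normalizer => //; apply: sub_generated; exists j.
have sN := normalizer_subgroup (V g n g).
by apply: apure_sub => // [|i ij]; [lia | apply: sigma_normalizer_V; lia].
Qed.

End HandlebodyBraids.

Arguments pure_between g n lo hi : clear implicits.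

Theorem theorem2 (g n : nat) (hg : (1 <= g)%N) (hn : (1 <= n)%N) :
  (iter_semidirect [seq Ubar g n i | i <- rev (iota 1 n)] (R g n) /\
   Ubar g n 1 = U g n g.+1) /\
  (iter_semidirect [seq Vbar g n i | i <- iota 1 g] (R g n) /\
   Vbar g n g = V g n g).
Proof.
have RE : R g n `&` pure_between g n 1 (g + n) = R g n.
  by apply/seteqP; split=> [x []|x Rx] //; split=> //; exact: R_sub_pure.
split; split; [|exact: Ubar1E| |exact: VbargE].
- by rewrite -RE; exact: iter_semidirect_Ubar.
- by rewrite -RE; apply: iter_semidirect_Vbar; rewrite ?add1n.
Qed.
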